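(* The association $\Sigma\mapsto Y_\Sigma$ of an irrational toric variety to a fan is functorial for maps of fans. That is, if $\Psi\colon\Sigma\to\Sigma'$ is a map of fans with $\Sigma\subset N$ and $\Sigma'\subset N'$, then there is a continuous map $\psi\colon Y_\Sigma\to Y_{\Sigma'}$ such that $$\psi(t.y)\ =\ \Psi(t).\psi(y)\qquad\text{for all } t\in T_N,\ y\in Y_\Sigma,$$ where the homomorphism $\Psi\colon T_N\to T_{N'}$ is induced by the linear map $\Psi\colon N\to N'$.
   Context: $N$, $N'$ are finite-dimensional real vector spaces with duals $M$, $M'$; pairings are written $u\cdot v$; $\mathbb{R}_>$, $\mathbb{R}_\geq$ are the positive and nonnegative reals. A polyhedral cone is a set $\mathbb{R}_\geq v_1+\dots+\mathbb{R}_\geq v_k$; the dual of a cone $\sigma\subset N$ is $\sigma^\vee=\{u\in M\mid u\cdot v\geq0\ \forall v\in\sigma\}$; a face of $\sigma$ is a set $\{v\in\sigma\mid u\cdot v=0\}$ with $u\in\sigma^\vee$, and similarly for cones in $M$. A fan $\Sigma\subset N$ is a finite collection of polyhedral cones in $N$ closed under taking faces such that any two of its cones meet in a common face. A map of fans $\Psi\colon\Sigma\to\Sigma'$ is a linear map $\Psi\colon N\to N'$ such that for each $\sigma\in\Sigma$ there is $\sigma'\in\Sigma'$ with $\Psi(\sigma)\subset\sigma'$. $T_N$ is $N$ as a multiplicative group, identified with the group of continuous homomorphisms $M\to\mathbb{R}_>$ by $v\mapsto\gamma_v$, $\gamma_v(u)=\exp(-u\cdot v)$; for $t=\gamma_v$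 write $t^u=\gamma_v(u)$. The homomorphism $T_N\to T_{N'}$ induced by $\Psi$ is $\gamma_v\mapsto\gamma_{\Psi(v)}$. For a polyhedral cone $C\subset M$, $\mathrm{Hom}_c(C,\mathbb{R}_\geq)$ is the set of monoid homomorphisms $\varphi\colon(C,+)\to(\mathbb{R}_\geq,\times)$ (so $\varphi(0)=1$) that are continuous on the relative interior of each face of $C$, with the weakest topology making all evaluations at points of $C$ continuous. $T_N$ acts by $(t.\varphi)(u)=t^u\varphi(u)$. For $\sigma\in\Sigma$ put $V_\sigma=\mathrm{Hom}_c(\sigma^\vee,\mathbb{R}_\geq)$. For $\tau$ a face of $\sigma$, restriction from $\tau^\vee$ to $\sigma^\vee$ gives a $T_N$-equivariant inclusion $V_\tau\hookrightarrow V_\sigma$. The irrational toric variety $Y_\Sigma=\bigcup_{\sigma\in\Sigma}V_\sigma$ is obtained by gluing the $V_\sigma$ along these inclusions, with its $T_N$-action. A map of irrational toric varieties $Y_\Sigma\to Y_{\Sigma'}$ is a continuous map together with a homomorphism $T_N\to T_{N'}$ of topological groups satisfying the displayed equivariance. *)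

(* Defs.v *)
From HB Require Import structures.
From mathcomp Require Import all_boot all_order all_algebra.
From mathcomp Require Import all_classical all_reals all_analysis.
From Stdlib Require Import Relation_Operators.

Set Implicit Arguments.
Unset Strict Implicit.
Unset Printing Implicit Defensive.

Import Order.TTheory GRing.Theory Num.Theory.
Import numFieldNormedType.Exports.
Import VectorInternalTheory.

Local Open Scope classical_set_scope.
Local Open Scope ring_scope.

(** * Duality, cones and faces *)

Definition dual (R : realType) (N : vectType R) : Type := 'Hom(N, R^o).

Section Dual.
Variables (R : realType) (N : vectType R).

HB.instance Definition _ := Vector.on (dual N).

(* The usual topology of the finite-dimensional space M, transported from R^n
   by the coordinate isomorphism [v2r]; it does not depend on coordinates. *)
HB.instance Definition _ :=
  Topological.copy (dual N) (initial_topology (@v2r R (dual N))).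

Definition pairing (u : dual N) (v : N) : R := (u : 'Hom(N, R^o)) v.

End Dual.

Section Cones.
Variable R : realType.

Definition polyhedral_cone (V : vectType R) (s : set V) : Prop :=
  exists (k : nat) (v : 'I_k -> V),
    s = [set x | exists2 a : 'I_k -> R,
           (forall i, 0 <= a i) & x = \sum_i a i *: v i].

(* Stated for an arbitrary pairing, so that they apply to cones in N (with
   [pairing]) and to cones in M (with [pairing^~]) alike. *)
Definition dual_cone (U V : Type) (p : U -> V -> R) (s : set V) : set U :=
  [set u | forall v, s v -> 0 <= p u v].

Definition is_face (U V : Type) (p : U -> V -> R) (f s : set V) : Prop :=
  exists2 u, dual_cone p s u & f = [set v | s v /\ p u v = 0].

End Cones.

Section RelativeInterior.
Variables (R : realType) (N : vectType R).

Definition affine_hull (F : set (dual N)) : set (dual N) :=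
  [set x | exists (k : nat) (a : 'I_k -> R) (w : 'I_k -> dual N),
     [/\ forall i, F (w i), \sum_i a i = 1 & x = \sum_i a i *: w i]].

Definition relint (F : set (dual N)) : set (dual N) :=
  [set u | F u /\ \forall x \near u, affine_hull F x -> F x].

End RelativeInterior.

(** * Fans *)

Record fan (R : realType) (N : vectType R) := Fan {
  cones :> set (set N);
  fan_finite : finite_set cones;
  fan_polyhedral : forall s, cones s -> polyhedral_cone s;
  fan_face : forall s f, cones s -> is_face (@pairing R N) f s -> cones f;
  fan_meet : forall s s', cones s -> cones s' ->
    is_face (@pairing R N) (s `&` s') s /\
    is_face (@pairing R N) (s `&` s') s'
}.

Definition fan_map (R : realType) (N N' : vectType R) (S : fan N)
    (S' : fan N') (Psi : 'Hom(N, N')) : Prop :=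
  forall s, cones S s -> exists2 s', cones S' s' & Psi @` s `<=` s'.

(** * Affine irrational toric varieties *)

Section HomC.
Variables (R : realType) (N : vectType R).

(* The functions live on the subtype of the elements of C.  Being a monoid
   homomorphism is phrased through the values in M of the arguments. *)
Definition is_homc (C : set (dual N)) (phi : C -> R) : Prop :=
  [/\ forall u : C, 0 <= phi u,
      forall u : C, \val u = 0 -> phi u = 1,
      forall u w z : C, \val z = \val u + \val w -> phi z = phi u * phi w
    & forall F : set (dual N), is_face (fun v u => pairing u v) F C ->
        {within [set u : C | relint F (\val u)], continuous phi}].

(* As a subtype of the product space R^C, it carries the weakest topology
   making all evaluations at points of C continuous. *)
Definition homc (C : set (dual N)) : Type :=
  [set phi : {ptws C -> R} | is_homc phi].

HB.instance Definition _ (C : set (dual N)) := Topological.on (homc C).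
HB.instance Definition _ (C : set (dual N)) := SubType.on (homc C).

(* V_sigma *)
Definition affine_toric (s : set N) : Type := homc (dual_cone (@pairing R N) s).

HB.instance Definition _ (s : set N) := Topological.on (affine_toric s).
HB.instance Definition _ (s : set N) := SubType.on (affine_toric s).

End HomC.

(** * The torus *)

(* [v : torus N] stands for the character [gamma_v : M -> R_>] and
   [tpow v u] is its value at u.  The group law of the torus is the addition
   of N. *)
Definition torus (R : realType) (N : vectType R) : Type := N.

Definition tpow (R : realType) (N : vectType R) (t : torus N) (u : dual N) : R :=
  expR (- pairing u t).

Definition torus_map (R : realType) (N N' : vectType R) (Psi : 'Hom(N, N')) :
  torus N -> torus N' := fun t => Psi t.

Section TorusAction.
Variables (R : realType) (N : vectType R).

Lemma pairing_continuous (v : N) : continuous (fun u : dual N => pairing u v).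
Proof.
pose n := dim (dual N).
pose e j : dual N := @r2v R (dual N) (delta_mx 0 j).
have -> : (fun u : dual N => pairing u v) =
   (fun r : 'rV[R]_n => \sum_j r 0 j * pairing (e j) v)
     \o (@v2r R (dual N)).
  apply/funext => u /=.
  rewrite -[u in LHS]v2rK {1}[v2r u]row_sum_delta /pairing linear_sum.
  rewrite sum_lfunE; apply: eq_bigr => j _.
  by rewrite linearZ scale_lfunE.
move=> u; apply: continuous_comp; first exact: initial_continuous.
have -> : (fun r : 'rV[R]_n => \sum_j r 0 j * pairing (e j) v) =
  \sum_j (fun r : 'rV[R]_n => r 0 j * pairing (e j) v).
  by apply/funext => r; rewrite fct_sumE.
elim/big_ind : _ => [|f g cf cg|j _]; first exact: cst_continuous.
- exact: (@continuousD R R^o _ f g).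
- by apply: continuousM; [exact: coord_continuous|exact: cst_continuous].
Qed.

Lemma tpow_continuous (t : torus N) : continuous (tpow t).
Proof.
move=> u; apply: continuous_comp; last exact: continuous_expR.
by apply: (@continuousN R R^o); exact: pairing_continuous.
Qed.

Lemma act_homc (C : set (dual N)) (t : torus N) (phi : homc C) :
  ((fun u => tpow t (\val u) * \val phi u) : {ptws C -> R})
    \in [set psi : {ptws C -> R} | is_homc psi].
Proof.
apply/mem_set; case: phi => phi /= /set_mem [phi0 phi1 phiM phic]; split => /=.
- by move=> u; rewrite mulr_ge0 ?expR_ge0.
- move=> u u0; rewrite phi1// /tpow u0 /pairing.
  by rewrite zero_lfunE oppr0 expR0 mulr1.
- move=> u w z zE; rewrite (phiM u w)// /tpow zE /pairing add_lfunE opprD expRD.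
  by rewrite mulrACA.
- move=> F hF u.
  apply: (@continuousM R (subspace [set u : C | relint F (sval u)])
    (fun u : C => tpow t (sval u)) phi); last exact: phic.
  apply: (@continuous_subspaceT _ _ _ (fun u : C => tpow t (\val u))) => {}u.
  apply: continuous_comp; last exact: tpow_continuous.
  exact: initial_continuous.
Qed.

Definition homc_act (C : set (dual N)) (t : torus N) (phi : homc C) : homc C :=
  SigSub (act_homc t phi).

End TorusAction.

(** * The irrational toric variety of a fan *)

Section ToricVariety.
Variables (R : realType) (N : vectType R) (S : fan N).

Definition charts : Type := {s : cones S & affine_toric (\val s)}.

HB.instance Definition _ := Topological.on charts.

(* x is a point of V_tau, y is a point of V_sigma, tau is a face of sigma and
   y is the restriction of x to the dual of sigma. *)
Definition glue (x y : charts) : Prop :=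
  is_face (@pairing R N) (\val (tag x)) (\val (tag y)) /\
  forall (u : dual_cone (@pairing R N) (\val (tag x)))
         (w : dual_cone (@pairing R N) (\val (tag y))),
    \val u = \val w -> \val (tagged x) u = \val (tagged y) w.

Definition glue_rel : rel charts :=
  fun x y => `[< clos_refl_sym_trans _ glue x y >].

Lemma glue_refl : reflexive glue_rel.
Proof. by move=> x; apply/asboolP; exact: rst_refl. Qed.

Lemma glue_sym : symmetric glue_rel.
Proof. by move=> x y; apply/asbool_equiv_eq; split; exact: rst_sym. Qed.

Lemma glue_trans : transitive glue_rel.
Proof.
by move=> y x z /asboolP xy /asboolP yz; apply/asboolP; exact: rst_trans xy yz.
Qed.

Canonical glue_equiv := EquivRel glue_rel glue_refl glue_sym glue_trans.

Local Open Scope quotient_scope.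

Definition toric_variety : Type := quotient_topology {eq_quot glue_equiv}.

HB.instance Definition _ := Topological.on toric_variety.
HB.instance Definition _ := Quotient.copy toric_variety {eq_quot glue_equiv}.

Definition charts_act (t : torus N) (x : charts) : charts :=
  existT _ (tag x) (homc_act t (tagged x)).

Definition toric_act (t : torus N) (y : toric_variety) : toric_variety :=
  \pi_toric_variety (charts_act t (repr y)).

Lemma glue_act t x y : glue x y -> glue (charts_act t x) (charts_act t y).
Proof.
move=> [fxy xy]; split=> //= u w uw.
by rewrite (xy u w uw) uw.
Qed.

Lemma toric_act_pi t x :
  toric_act t (\pi_toric_variety x) = \pi_toric_variety (charts_act t x).
Proof.
apply/eqmodP/asboolP; have /eqmodP/asboolP :
  (repr (\pi_toric_variety x)) = x %[mod {eq_quot glue_equiv}] by rewrite reprK.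
move: (repr _) => z; elim=> [a b ab|a|a b _ ab|a b c _ ab _ bc].
- by apply: rst_step; exact: glue_act.
- exact: rst_refl.
- exact: rst_sym ab.
- exact: rst_trans ab bc.
Qed.

End ToricVariety.

(* Main.v *)
Require Import Defs.
From HB Require Import structures.
From mathcomp Require Import all_boot all_order all_algebra.
From mathcomp Require Import all_classical all_reals all_analysis.
From Stdlib Require Import Relation_Operators.
Import numFieldNormedType.Exports.

Set Implicit Arguments.
Unset Strict Implicit.
Unset Printing Implicit Defensive.

Import Order.TTheory GRing.Theory Num.Theory.
Import VectorInternalTheory.

Local Open Scope classical_set_scope.
Local Open Scope ring_scope.

(** The adjoint of [Psi], called [pullback Psi] here, sends the dual cone of s'
    into the dual cone of s whenever Psi(s) is contained in s', and the map of
    affine varieties V_s -> V_s' is composition with this adjoint.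

    The one point of geometry is that composition with the adjoint preserves
    continuity on relative interiors of faces.  It does because the relative
    interior of a face F' of the dual of s' lands inside the relative interior
    of a single face of the dual of s.  Indeed, two points of relint F' vanish
    on the same vectors of s': the segment from one to the other can be
    prolonged inside F' at both ends, and a linear function that is nonnegative
    on a segment and zero at an inner point is zero on the whole segment
    ([relint_vanish]).  Hence their adjoints vanish on the same vectors of s.
    On the other side, since s is finitely generated, all the elements of its
    dual cone with a given zero set on s lie in the relative interior of one
    face ([relint_face_dual_cone]).

    Everything else is formal.  If s is sent into both s' and t', it is sent
    into their common face r', and the point of V_r' obtained from a point of
    V_s restricts to the two points of V_s' and V_t'.  The class in Y_S' is
    therefore independent of the cone chosen to contain Psi(s), and the same
    argument with two different cones of S shows compatibility with the gluing
    ([glue_affine_map]).  Thus the images of classes may be computed in any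
    convenient chart ([toric_mapE]), which gives identities and composition;
    equivariance is the adjunction formula and continuity follows from the
    universal properties of products, disjoint unions and quotients. *)

(** * Linear maps and the topology of the dual space *)

Lemma continuous_to_dual (R : realType) (N : vectType R) (X : topologicalType)
    (f : X -> dual N) :
  continuous (fun x => v2r (f x)) -> continuous f.
Proof. exact: (@continuous_comp_initial (dual N) X _ (@v2r R (dual N))). Qed.

Lemma dual_line_continuous (R : realType) (N : vectType R) (u w : dual N) :
  continuous (fun e : R => u + e *: w).
Proof.
apply: continuous_to_dual => e.
have -> : (fun e : R => v2r (u + e *: w)) = (fun e : R => v2r u + e *: v2r w).
  by apply/funext => x; rewrite linearD linearZ.
apply: (@continuousD R 'rV[R]_(dim (dual N)) R (cst (v2r u))
  (fun e : R => e *: v2r w)).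
  exact: cst_continuous.
exact: scalel_continuous.
Qed.

(** The adjoint of [Psi] with respect to the pairings. *)
Definition pullback (R : realType) (N N' : vectType R) (Psi : 'Hom(N, N'))
  (u : dual N') : dual N := ((u : 'Hom(N', R^o)) \o Psi)%VF.

Lemma pairing_pullback (R : realType) (N N' : vectType R) (Psi : 'Hom(N, N'))
    (u : dual N') (v : N) :
  pairing (pullback Psi u) v = pairing u (Psi v).
Proof. exact: comp_lfunE. Qed.

(** The topology of the dual is defined through coordinates, so the adjoint is
    expanded on the coordinate basis, where its coefficients are the coordinate
    functions. *)
Lemma pullback_continuous (R : realType) (N N' : vectType R)
  (Psi : 'Hom(N, N')) : continuous (pullback Psi).
Proof.
apply: continuous_to_dual.
pose e j : dual N' := r2v (delta_mx 0 j).
have -> : (fun u => v2r (pullback Psi u)) =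
    \sum_j (fun u => v2r u 0 j *: v2r (pullback Psi (e j))).
  apply/funext => u; rewrite fct_sumE.
  rewrite -[u in LHS]v2rK {1}[v2r u]row_sum_delta linear_sum.
  transitivity (v2r (\sum_j v2r u 0 j *: pullback Psi (e j))).
    congr v2r; apply/lfunP => v.
    rewrite comp_lfunE !sum_lfunE; apply: eq_bigr => j _.
    by rewrite linearZ !scale_lfunE comp_lfunE.
  by rewrite linear_sum; apply: eq_bigr => j _; rewrite linearZ.
elim/big_ind : _ => [|f g cf cg|j _]; first exact: cst_continuous.
- by move=> u; move: (cf u) (cg u); exact: continuousD.
- move=> u; apply: (@continuousZr_tmp R _ (dual N') (fun u => v2r u 0 j)).
  apply: (@continuous_comp (dual N') _ _ (@v2r R (dual N'))
    (fun r : 'rV[R]_(dim (dual N')) => r 0 j)); first exact: initial_continuous.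
  exact: coord_continuous.
Qed.

Lemma pullback_id (R : realType) (N : vectType R) (u : dual N) :
  pullback \1%VF u = u.
Proof. exact: comp_lfun1r. Qed.

Lemma pullback_comp (R : realType) (N N' N'' : vectType R)
    (Psi : 'Hom(N, N')) (Psi' : 'Hom(N', N'')) (u : dual N'') :
  pullback (Psi' \o Psi)%VF u = pullback Psi (pullback Psi' u).
Proof. exact: comp_lfunA. Qed.

(** * Relative interiors of faces of a dual cone *)

Lemma polyhedral_dualP (R : realType) (N : vectType R) (s : set N) :
  polyhedral_cone s -> exists (k : nat) (v : 'I_k -> N),
    (forall i, s (v i)) /\
    forall u : dual N,
      (forall i, 0 <= pairing u (v i)) -> dual_cone (@pairing R N) s u.
Proof.
move=> [k [v ->]]; exists k, v; split=> [i|u hu _ [a a0 ->]].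
  exists (fun j => (j == i)%:R) => [j|]; first exact: ler0n.
  rewrite (bigD1 i)//= eqxx scale1r big1 ?addr0// => j /negbTE ->.
  by rewrite scale0r.
rewrite /pairing linear_sum; apply: sumr_ge0 => i _.
by rewrite linearZ mulr_ge0//; exact: hu.
Qed.

Lemma pairing_affine_hull (R : realType) (N : vectType R) (F : set (dual N))
    (v : N) :
  (forall w, F w -> pairing w v = 0) ->
  forall x, affine_hull F x -> pairing x v = 0.
Proof.
move=> F0 _ [k [a [w [Fw _ ->]]]].
rewrite /pairing sum_lfunE big1// => i _.
by rewrite scale_lfunE (_ : (w i : 'Hom(_,_)) v = 0) ?scaler0//; exact: F0.
Qed.

(** Let [vz] be the sum of the generators of s on which [u0] vanishes.  The face
    that [vz] cuts out consists of the elements vanishing on these generators,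
    and its affine hull satisfies the same equations.  Inside the hull, an
    element with the same zeros as [u0] is strictly positive on the finitely
    many other generators, and stays so nearby; this makes it relatively
    interior. *)
Lemma relint_face_dual_cone (R : realType) (N : vectType R) (s : set N)
    (u0 : dual N) :
  polyhedral_cone s -> dual_cone (@pairing R N) s u0 ->
  exists2 F : set (dual N),
    is_face (fun v u => pairing u v) F (dual_cone (@pairing R N) s) &
    forall u, dual_cone (@pairing R N) s u ->
      (forall v, s v -> pairing u0 v = 0 -> pairing u v = 0) ->
      (forall v, s v -> pairing u v = 0 -> pairing u0 v = 0) -> relint F u.
Proof.
move=> /polyhedral_dualP [k [v [sv sdual]]] su0.
pose vz := \sum_(i | pairing u0 (v i) == 0) v i.
have pz w : pairing w vz = \sum_(i | pairing u0 (v i) == 0) pairing w (v i).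
  exact: linear_sum.
exists [set u | dual_cone (@pairing R N) s u /\ pairing u vz = 0].
  exists vz => // u su /=; rewrite pz; apply: sumr_ge0 => i _; exact: su.
move=> u su u0u uu0.
have uz : pairing u vz = 0 by rewrite pz big1// => i /eqP; exact: u0u.
split=> //.
have pos : \forall x \near u, forall i,
    0 < pairing u (v i) -> 0 < pairing x (v i).
  apply: (@filter_forall _ _
    (fun i x => 0 < pairing u (v i) -> 0 < pairing x (v i)) (nbhs u)) => i.
  have [ui|_] := ltP 0 (pairing u (v i)); last by near=> x.
  near=> x => _; near: x.
  exact: (@pairing_continuous R N (v i) u _ (lt_nbhsr ui)).
near=> x => hx.
have x0 i : pairing u (v i) = 0 -> pairing x (v i) = 0.
  (* the nonnegative terms of w . vz = 0 must all vanish *)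
  move=> ui; apply: pairing_affine_hull hx => w [sw].
  rewrite pz => /eqP; rewrite psumr_eq0 => [/allP/(_ i)|j _]; last exact: sw.
  by rewrite mem_index_enum uu0// eqxx /= => /(_ isT)/eqP.
split.
  apply: sdual => i.
  have [ui|ui] := ltP 0 (pairing u (v i)).
    apply: ltW; move: i ui; near: x; exact: pos.
  by rewrite x0//; apply/eqP; rewrite eq_le ui su.
by rewrite pz big1// => i /eqP ui; rewrite x0// u0u.
Unshelve. all: by end_near.
Qed.

(** The line through [w] and [u] lies in the affine hull of F, so its points
    close enough to [u] lie in F, including some beyond [u]. *)
Lemma relint_extend (R : realType) (N : vectType R) (F : set (dual N))
    (u w : dual N) :
  relint F u -> F w -> exists2 e : R, 0 < e & F (u + e *: (u - w)).
Proof.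
move=> [Fu uF] Fw.
have aff e : affine_hull F (u + e *: (u - w)).
  exists 2%N, (fun i => if i == 0 then 1 + e else - e),
    (fun i => if i == 0 then u else w); split.
  - by move=> i; case: ifP.
  - by rewrite big_ord_recl big_ord1 /= addrK.
  - rewrite big_ord_recl big_ord1 /= scalerDl scale1r scaleNr scalerBr.
    by rewrite addrA.
have := @dual_line_continuous R N u (u - w) 0.
rewrite /continuous_at scale0r addr0 => /(_ _ uF)/nbhs_ballP[d /= d0 hd].
exists (d / 2); first exact: divr_gt0.
apply: (hd (d / 2)) => //=.
rewrite /ball /= sub0r normrN gtr0_norm ?divr_gt0//.
by rewrite ltr_pdivrMr// ltr_pMr// ltr1n.
Qed.

(** At a point of F beyond [u] the value is [- e * pairing w v] with [0 < e];
    this and [pairing w v] are both nonnegative. *)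
Lemma relint_vanish (R : realType) (N : vectType R) (F : set (dual N))
    (v : N) (u w : dual N) :
  (forall x, F x -> 0 <= pairing x v) -> relint F u -> F w ->
  pairing u v = 0 -> pairing w v = 0.
Proof.
move=> F0 Fu Fw uv; have [e e0 /F0] := relint_extend Fu Fw.
rewrite /pairing add_lfunE scale_lfunE add_lfunE opp_lfunE.
rewrite (_ : (u : 'Hom(_,_)) v = 0)// !add0r scalerN oppr_ge0 => ewv.
apply/eqP; rewrite eq_le F0// andbT.
by rewrite -(pmulr_rle0 _ e0).
Qed.

(** * The map of affine varieties *)

Lemma pullback_dual_cone (R : realType) (N N' : vectType R) (Psi : 'Hom(N, N'))
    (s : set N) (s' : set N') (h : Psi @` s `<=` s') (u : dual N') :
  dual_cone (@pairing R N') s' u ->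
  dual_cone (@pairing R N) s (pullback Psi u).
Proof.
by move=> us' v sv; rewrite pairing_pullback; apply: us'; apply: h; exists v.
Qed.

Definition pull_cone (R : realType) (N N' : vectType R) (Psi : 'Hom(N, N'))
    (s : set N) (s' : set N') (h : Psi @` s `<=` s')
    (u : dual_cone (@pairing R N') s') : dual_cone (@pairing R N) s :=
  SigSub (mem_set (pullback_dual_cone h (set_mem (valP u)))).

Lemma pull_cone_continuous (R : realType) (N N' : vectType R)
    (Psi : 'Hom(N, N')) (s : set N) (s' : set N') (h : Psi @` s `<=` s') :
  continuous (pull_cone h).
Proof.
apply: (@continuous_comp_initial _ _ _ set_val).
move=> u; apply: (@continuous_comp _ _ _
  (set_val : dual_cone (@pairing R N') s' -> dual N') (pullback Psi)).
  exact: initial_continuous.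
exact: pullback_continuous.
Qed.

(** A point [u0] of relint F' determines, by the zeros of its adjoint on s, a
    face F of the dual of s.  As all points of relint F' share these zeros, the
    adjoint maps relint F' to relint F, where [phi] is continuous. *)
Lemma pullback_homc (R : realType) (N N' : vectType R) (Psi : 'Hom(N, N'))
    (s : set N) (s' : set N') (h : Psi @` s `<=` s') (phi : affine_toric s) :
  polyhedral_cone s ->
  is_homc (fun u : dual_cone (@pairing R N') s' => \val phi (pull_cone h u)).
Proof.
move=> ps; case: phi => phi /= /set_mem [phi0 phi1 phiM phic]; split => /=.
- by move=> u; exact: phi0.
- move=> u u0; apply: phi1 => /=; rewrite u0.
  by apply/lfunP => v; rewrite comp_lfunE !zero_lfunE.
- move=> u w z zE; apply: phiM => /=; rewrite zE.
  by apply/lfunP => v; rewrite comp_lfunE !add_lfunE !comp_lfunE.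
- move=> F' [v' _ F'E]; apply/subspace_continuousP => u0 /= ru0.
  have F's : F' `<=` dual_cone (@pairing R N') s' by rewrite F'E => w [].
  have [F faceF relF] :=
    relint_face_dual_cone ps (set_mem (valP (pull_cone h u0))).
  (* all of relint F' lands in the relative interior of the face of u0 *)
  have rel u : relint F' (\val u) -> relint F (\val (pull_cone h u)).
    move=> ru; apply: relF; first exact: (set_mem (valP (pull_cone h u))).
      move=> v sv /=; rewrite !pairing_pullback.
      apply: relint_vanish ru0 (proj1 ru) => x /F's; apply.
      by apply: h; exists v.
    move=> v sv /=; rewrite !pairing_pullback.
    apply: relint_vanish ru (proj1 ru0) => x /F's; apply.
    by apply: h; exists v.
  move: (phic F faceF) => /subspace_continuousP.
  move=> /(_ (pull_cone h u0) (rel _ ru0)).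
  apply: (@cvg_comp _ _ _ (pull_cone h) phi) => A nA.
  have nG : nbhs u0
      [set u | relint F (\val (pull_cone h u)) -> A (pull_cone h u)].
    exact: (@pull_cone_continuous _ _ _ _ _ _ h u0 _ nA).
  rewrite /nbhs /= /within /=.
  by apply: (@filterS _ _ _ _ _ _ nG) => u /= + ru; apply; exact: rel.
Qed.

Definition affine_map (R : realType) (N N' : vectType R) (Psi : 'Hom(N, N'))
    (s : set N) (s' : set N') (ps : polyhedral_cone s) (h : Psi @` s `<=` s')
    (phi : affine_toric s) : affine_toric s' :=
  SigSub (mem_set (pullback_homc h phi ps)).

Lemma continuous_to_ptws (I : Type) (X Y : topologicalType)
    (f : X -> {ptws I -> Y}) :
  (forall i, continuous (fun x => f x i)) -> continuous f.
Proof.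
move=> cf x; apply/cvg_sup => i.
exact: (@continuous_comp_initial _ _ _ (fun g : I -> Y => g i) f (cf i)).
Qed.

Lemma affine_map_continuous (R : realType) (N N' : vectType R)
    (Psi : 'Hom(N, N')) (s : set N) (s' : set N') (ps : polyhedral_cone s)
    (h : Psi @` s `<=` s') : continuous (affine_map ps h).
Proof.
apply: (@continuous_comp_initial _ _ _ set_val).
apply: continuous_to_ptws => u phi.
apply: (@continuous_comp _ _ _ (set_val : affine_toric s -> {ptws _ -> R})
  (fun g => g (pull_cone h u))).
  exact: initial_continuous.
exact: proj_continuous.
Qed.

(** * Descent to the glued varieties *)

Definition chart (R : realType) (N : vectType R) (S : fan N) (s : set N)
    (hs : cones S s) (phi : affine_toric s) : charts S :=
  existT (fun s : cones S => affine_toric (\val s)) (SigSub (mem_set hs)) phi.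

Definition toric_pi (R : realType) (N : vectType R) (S : fan N)
  (x : charts S) : toric_variety S := (\pi_(toric_variety S) x)%qT.

Lemma glue_toric_pi (R : realType) (N : vectType R) (S : fan N)
    (x y : charts S) : Defs.glue x y -> toric_pi x = toric_pi y.
Proof. by move=> xy; apply/eqmodP/asboolP; exact: rst_step. Qed.

(** Both images come from the chart of the common face r' of s' and t': the
    cone of [x] is a face of that of [y], so it is sent into t' as well as s',
    and the point of V_r' obtained from [x] restricts to the images of [x] and
    [y].
    With [x = y], this says that the choice of a target cone does not matter. *)
Lemma glue_affine_map (R : realType) (N N' : vectType R) (S : fan N)
    (S' : fan N') (Psi : 'Hom(N, N')) (x y : charts S) (s' t' : set N')
    (hs' : cones S' s') (ht' : cones S' t')
    (px : polyhedral_cone (\val (tag x))) (py : polyhedral_cone (\val (tag y)))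
    (hx : Psi @` \val (tag x) `<=` s') (hy : Psi @` \val (tag y) `<=` t') :
  Defs.glue x y ->
  toric_pi (chart hs' (affine_map px hx (tagged x))) =
  toric_pi (chart ht' (affine_map py hy (tagged y))).
Proof.
move=> [[u0 _ xy] gxy].
have [fs ft] := fan_meet hs' ht'.
have hr : cones S' (s' `&` t') by exact: fan_face fs.
have xr : Psi @` \val (tag x) `<=` s' `&` t'.
  rewrite subsetI; split=> //; apply: subset_trans hy; apply: image_subset.
  by rewrite xy => v [].
transitivity (toric_pi (chart hr (affine_map px xr (tagged x)))).
  apply/esym/glue_toric_pi; split=> //= u w uw.
  by congr (\val (tagged x) _); apply: val_inj => /=; rewrite uw.
apply: glue_toric_pi; split=> //= u w uw.
by apply: gxy => /=; rewrite uw.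
Qed.

Lemma glue_reflexive (R : realType) (N : vectType R) (S : fan N)
    (x : charts S) : Defs.glue x x.
Proof.
split=> [|u w /val_inj -> //].
exists 0 => [v _|]; rewrite /pairing; first by rewrite zero_lfunE.
by apply/seteqP; split=> [v sv|v []//]; split; rewrite ?zero_lfunE.
Qed.

Definition target_cone (R : realType) (N N' : vectType R) (S : fan N)
    (S' : fan N') (Psi : 'Hom(N, N')) (h : fan_map S S' Psi) (s : cones S) :
    {s' : set N' | cones S' s' & Psi @` \val s `<=` s'} :=
  cid2 (h (\val s) (set_mem (valP s))).

Definition chart_map (R : realType) (N N' : vectType R) (S : fan N)
    (S' : fan N') (Psi : 'Hom(N, N')) (h : fan_map S S' Psi) (x : charts S) :
    charts S' :=
  chart (s2valP (target_cone h (tag x)))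
    (affine_map (fan_polyhedral (set_mem (valP (tag x))))
      (s2valP' (target_cone h (tag x))) (tagged x)).

Definition toric_map (R : realType) (N N' : vectType R) (S : fan N)
    (S' : fan N') (Psi : 'Hom(N, N')) (h : fan_map S S' Psi)
    (y : toric_variety S) : toric_variety S' :=
  toric_pi (chart_map h (repr y)).

Lemma toric_map_pi (R : realType) (N N' : vectType R) (S : fan N)
    (S' : fan N') (Psi : 'Hom(N, N')) (h : fan_map S S' Psi) (x : charts S) :
  toric_map h (toric_pi x) = toric_pi (chart_map h x).
Proof.
have /eqmodP/asboolP : (repr (toric_pi x)) = x %[mod (toric_variety S)]%qT.
  by rewrite reprK.
rewrite /toric_map; move: (repr _) => z.
elim=> [a b ab|//|a b _ //|a b c _ -> _ -> //].
exact: glue_affine_map.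
Qed.

(** The freedom to choose the target cone [s'] is what makes the identity and
    composition laws immediate. *)
Lemma toric_mapE (R : realType) (N N' : vectType R) (S : fan N)
    (S' : fan N') (Psi : 'Hom(N, N')) (h : fan_map S S' Psi) (x : charts S)
    (s' : set N') (hs' : cones S' s') (px : polyhedral_cone (\val (tag x)))
    (hx : Psi @` \val (tag x) `<=` s') :
  toric_map h (toric_pi x) =
  toric_pi (chart hs' (affine_map px hx (tagged x))).
Proof. by rewrite toric_map_pi; apply/glue_affine_map/glue_reflexive. Qed.

Lemma toric_map_continuous (R : realType) (N N' : vectType R) (S : fan N)
    (S' : fan N') (Psi : 'Hom(N, N')) (h : fan_map S S' Psi) :
  continuous (toric_map h).
Proof.
apply/quotient_continuous.
have -> : toric_map h \o \pi_(toric_variety S)%qT =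
    @toric_pi R N' S' \o chart_map h.
  by apply/funext => x; exact: toric_map_pi.
move=> x; apply: (@continuous_comp (charts S) (charts S') (toric_variety S')
    (chart_map h) (@toric_pi R N' S')); last exact: pi_continuous.
pose f (s : cones S) (phi : affine_toric (\val s)) :=
  chart_map h (existT _ s phi).
apply: (@sigT_continuous _ (fun s : cones S => affine_toric (\val s))
  (charts S') f) => s phi.
rewrite /f /chart_map /chart /=.
apply: (@continuous_comp (affine_toric (\val s))
  (affine_toric (s2val (target_cone h s))) (charts S')
  (affine_map (fan_polyhedral (set_mem (valP s)))
      (s2valP' (target_cone h s))) _ phi).
  exact: affine_map_continuous.
exact: (@existT_continuous _ (fun s => affine_toric (\val s))).
Qed.

Lemma toric_ind (R : realType) (N : vectType R) (S : fan N)
    (P : toric_variety S -> Prop) :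
  (forall x, P (toric_pi x)) -> forall y, P y.
Proof. by move=> Px y; rewrite -[y]reprK; exact: Px. Qed.

Lemma toric_map_act (R : realType) (N N' : vectType R) (S : fan N)
    (S' : fan N') (Psi : 'Hom(N, N')) (h : fan_map S S' Psi) (t : torus N)
    (y : toric_variety S) :
  toric_map h (toric_act t y) = toric_act (torus_map Psi t) (toric_map h y).
Proof.
elim/toric_ind: y => x.
rewrite toric_act_pi !toric_map_pi toric_act_pi; congr toric_pi.
congr (existT _ _ _); apply: val_inj; apply/funext => u /=.
by rewrite /tpow pairing_pullback.
Qed.

Lemma toric_map_id (R : realType) (N : vectType R) (S : fan N)
    (h : fan_map S S \1%VF) (y : toric_variety S) : toric_map h y = y.
Proof.
elim/toric_ind: y => x.
have px := fan_polyhedral (set_mem (valP (tag x))).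
have hx : \1%VF @` \val (tag x) `<=` \val (tag x).
  by move=> _ [v sv <-]; rewrite id_lfunE.
rewrite (toric_mapE h (set_mem (valP (tag x))) px hx).
apply: glue_toric_pi; split=> [|u w uw] /=.
  by have [] := glue_reflexive x.
by congr (\val (tagged x) _); apply: val_inj; rewrite /= pullback_id.
Qed.

(** The composite is computed in the target cone reached in two steps. *)
Lemma toric_map_comp (R : realType) (N N' N'' : vectType R) (S : fan N)
    (S' : fan N') (S'' : fan N'') (Psi : 'Hom(N, N')) (Psi' : 'Hom(N', N''))
    (h : fan_map S S' Psi) (h' : fan_map S' S'' Psi')
    (h'' : fan_map S S'' (Psi' \o Psi)%VF) (y : toric_variety S) :
  toric_map h'' y = toric_map h' (toric_map h y).
Proof.
elim/toric_ind: y => x.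
have px := fan_polyhedral (set_mem (valP (tag x))).
rewrite [in RHS]toric_map_pi.
set x' := chart_map h x.
set x'' := chart_map h' x'.
have hx : (Psi' \o Psi)%VF @` \val (tag x) `<=` \val (tag x'').
  move=> _ [v sv <-]; rewrite comp_lfunE.
  apply: (s2valP' (target_cone h' (tag x'))); exists (Psi v) => //.
  by apply: (s2valP' (target_cone h (tag x))); exists v.
rewrite [in RHS]toric_map_pi (toric_mapE h'' (set_mem (valP (tag x''))) px hx).
apply: glue_toric_pi; split=> [|u w uw] /=.
  by have [] := glue_reflexive x''.
by congr (\val (tagged x) _); apply: val_inj; rewrite /= pullback_comp uw.
Qed.

Theorem theorem3p15 (R : realType) :
  exists psi : forall (N N' : vectType R) (S : fan N) (S' : fan N')
      (Psi : 'Hom(N, N')),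
      fan_map S S' Psi -> toric_variety S -> toric_variety S',
  [/\ forall (N N' : vectType R) (S : fan N) (S' : fan N') (Psi : 'Hom(N, N'))
        (hPsi : fan_map S S' Psi),
        continuous (psi N N' S S' Psi hPsi) /\
        forall (t : torus N) (y : toric_variety S),
          psi N N' S S' Psi hPsi (toric_act t y) =
          toric_act (torus_map Psi t) (psi N N' S S' Psi hPsi y),
      forall (N : vectType R) (S : fan N) (hid : fan_map S S \1%VF)
        (y : toric_variety S),
        psi N N S S \1%VF hid y = y
    & forall (N N' N'' : vectType R) (S : fan N) (S' : fan N') (S'' : fan N'')
        (Psi : 'Hom(N, N')) (Psi' : 'Hom(N', N''))
        (h : fan_map S S' Psi) (h' : fan_map S' S'' Psi')
        (h'' : fan_map S S'' (Psi' \o Psi)%VF) (y : toric_variety S),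
        psi N N'' S S'' (Psi' \o Psi)%VF h'' y =
        psi N' N'' S' S'' Psi' h' (psi N N' S S' Psi h y)].
Proof.
exists (fun N N' S S' Psi h => @toric_map R N N' S S' Psi h); split.
- move=> N N' S S' Psi h; split; first exact: toric_map_continuous.
  exact: toric_map_act.
- move=> N S hid y; exact: toric_map_id.
- move=> N N' N'' S S' S'' Psi Psi' h h' h'' y; exact: toric_map_comp.
Qed.
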